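(* Let $X$ be a set. A sub-Möbius structure $M$ on $X$ is a Möbius structure (i.e. $M=M_d$ for some semi-metric $d$ on $X$) if and only if for every scale triple $A=(\alpha,\beta,\omega)\in X^3$ and every admissible 5-tuple $P=(x,y,\alpha,\beta,\omega)$ the following two conditions are satisfied: (A) $b(P_1)+b(P_4)=b(P_3)-a(P_1)$ whenever $y\neq\alpha,\beta$; (B) $b(P_2)=-a(P_4)+b(P_1)$ whenever $y\neq\alpha,\omega$.
   Context: Let $X$ be a set. A 4-tuple in $X^4$ is admissible if no element occurs three or four times among its entries, and nondegenerate if its entries are pairwise distinct. $\mathcal P_4$ is the set of ordered admissible 4-tuples. Put $L_4=\{(a,b,c)\in\mathbb R^3: a+b+c=0\}$ and $\overline L_4=L_4\cup\{(0,\infty,-\infty),(-\infty,0,\infty),(\infty,-\infty,0)\}$. Permutations $\pi\in S_k$ are written $\pi=i_1\dots i_k$ with $i_j=\pi(j)$. $S_4$ acts on $\mathcal P_4$ by $\pi(x_1,x_2,x_3,x_4)=(x_{\pi(1)},x_{\pi(2)},x_{\pi(3)},x_{\pi(4)})$, and for $\sigma\in S_3$, $v\in\overline L_4$ put $\sigma v=(v_{\sigma(1)},v_{\sigma(2)},v_{\sigma(3)})$. The cross-ratio homomorphism $\varphi:S_4\to S_3$ is the homomorphism with kernel the Klein group $\{1234,2143,4321,3412\}$ and $\varphi(2134)=132$, $\varphi(3214)=321$, $\varphi(4231)=213$, $\varphi(2431)=231$, $\varphi(3241)=312$. A sub-Möbius structure on $X$ is a map $M:\mathcal P_4\to\overline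 L_4$ such that: (a) $M(\pi P)=\operatorname{sign}(\pi)\varphi(\pi)M(P)$ for all $P\in\mathcal P_4$, $\pi\in S_4$ (with $-(\pm\infty)=\mp\infty$); (b) $M(P)\in L_4$ if and only if $P$ is nondegenerate; (c) $M(x_1,x_1,x_3,x_4)=(0,\infty,-\infty)$ for every $(x_1,x_1,x_3,x_4)\in\mathcal P_4$. Write $M(P)=(a(P),b(P),c(P))$. A scale triple is a triple $(\alpha,\beta,\omega)\in X^3$ of pairwise distinct points. A 5-tuple is admissible if each of the five 4-tuples obtained by deleting one entry is admissible. For $P=(x,y,\alpha,\beta,\omega)$ put $P_1=(y,\alpha,\beta,\omega)$, $P_2=(x,\alpha,\beta,\omega)$, $P_3=(x,y,\beta,\omega)$, $P_4=(x,y,\alpha,\omega)$. Under the restrictions on $y$ in (A), (B) all sums involved are well defined in $\mathbb R\cup\{\pm\infty\}$. A semi-metric on $X$ is a symmetric function $d:X^2\to\mathbb R\cup\{\infty\}$, positive off the diagonal, zero on the diagonal, with at most one infinitely remote point $\omega$, i.e. a point with $d(x,\omega)=\infty$ for all $x\ne\omega$ (all other values of $d$ being finite). With $(x|y)=-\ln d(x,y)$, the Möbius structure $M_d:\mathcal P_4\to\overline L_4$ associated with $d$ is $M_d(x_1,x_2,x_3,x_4)=(a,b,c)$, where $a=(x_1|x_4)+(x_2|x_3)-(x_1|x_3)-(x_2|x_4)$, $b=(x_1|x_2)+(x_3|x_4)-(x_1|x_4)-(x_2|x_3)$, $c=(x_2|x_4)+(x_1|x_3)-(x_1|x_2)-(x_3|x_4)$.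 If exactly one entry is the infinitely remote point of $d$, the terms containing it cancel. On degenerate tuples $M_d$ equals $(0,\infty,-\infty)$ if $x_1=x_2$ or $x_3=x_4$; $(-\infty,0,\infty)$ if $x_1=x_3$ or $x_2=x_4$; $(\infty,-\infty,0)$ if $x_1=x_4$ or $x_2=x_3$. *)

(* Defs.v *)
From mathcomp Require Import all_boot all_order all_fingroup all_algebra.
From mathcomp Require Import boolp reals ereal exp.

Set Implicit Arguments.
Unset Strict Implicit.
Unset Printing Implicit Defensive.
Import Order.TTheory GRing.Theory Num.Theory.

Local Open Scope ring_scope.

Definition perm_tuple (T : Type) (n : nat) (p : 'S_n) (t : n.-tuple T) :
  n.-tuple T := [tuple tnth t (p i) | i < n].

Definition delete_entry (T : Type) (n : nat) (i : 'I_n.+1) (t : n.+1.-tuple T) :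
  n.-tuple T := [tuple tnth t (lift i j) | j < n].

(* i_1 ... i_n with i_j = s(j), entries numbered from 1. *)
Definition one_line (n : nat) (s : 'S_n) : seq nat :=
  [seq (val (s i)).+1 | i <- enum 'I_n].

(* Index of the splitting of {0,1,2,3} into two pairs one of which is {i, j}:
   0 for 01|23, 1 for 02|13, 2 for 03|12 (only the sum i + j matters). *)
Definition splitting (i j : 'I_4) : 'I_3 :=
  match (val i + val j)%N with
  | 1%N | 5%N => @Ordinal 3 0 isT
  | 2%N | 4%N => @Ordinal 3 1 isT
  | _ => @Ordinal 3 2 isT
  end.

(* S_4 acts on the three splittings; the splitting of index j is the one in
   which 0 is paired with j + 1 = lift ord0 j. *)
Definition cross_ratio_fun (s : 'S_4) (j : 'I_3) : 'I_3 :=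
  splitting (s ord0) (s (lift ord0 j)).

Lemma splitting_inj (a b c : 'I_4) :
  a != b -> a != c -> splitting a b = splitting a c -> b = c.
Proof.
by case: a b c => [[|[|[|[|//]]]] ?] [[|[|[|[|//]]]] ?] [[|[|[|[|//]]]] ?] //=;
  move=> ? ? ?; apply: val_inj.
Qed.

Lemma splittingC (a b c d : 'I_4) :
  uniq [:: a; b; c; d] -> splitting a b = splitting c d.
Proof.
by case: a b c d => [[|[|[|[|//]]]] ?] [[|[|[|[|//]]]] ?]
  [[|[|[|[|//]]]] ?] [[|[|[|[|//]]]] ?] //=.
Qed.

Lemma splitting_sym (a b : 'I_4) : splitting a b = splitting b a.
Proof. by rewrite /splitting addnC. Qed.

Lemma cross_ratio_fun_inj (s : 'S_4) : injective (cross_ratio_fun s).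
Proof.
move=> i j /splitting_inj e; apply: (@lift_inj _ ord0).
by apply: (@perm_inj _ s); apply: e; rewrite (inj_eq perm_inj) neq_lift.
Qed.

Definition cross_ratio_hom (s : 'S_4) : 'S_3 := perm (@cross_ratio_fun_inj s).

Lemma splitting_perm (t : 'S_4) (a b : 'I_4) : a != b ->
  splitting (t a) (t b) = splitting (t ord0) (t (lift ord0 (splitting a b))).
Proof.
move=> nab; have [a0|a0] := eqVneq a ord0.
  rewrite a0 in nab *; congr (splitting _ (t _)); apply: val_inj.
  by case: b nab => [[|[|[|[|//]]]] ?].
have [b0|b0] := eqVneq b ord0.
  rewrite splitting_sym b0 in nab *.
  congr (splitting _ (t _)); apply: val_inj.
  by case: a nab a0 => [[|[|[|[|//]]]] ?].
apply: splittingC; rewrite -[X in uniq X]/(map t [:: a; b; _; _]).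
rewrite (map_inj_uniq perm_inj); move: nab a0 b0.
by case: a b => [[|[|[|[|//]]]] ?] [[|[|[|[|//]]]] ?].
Qed.

(* In this library (s * t) i = t (s i); homomorphisms are the same for the
   opposite convention. *)
Lemma cross_ratio_homM (s t : 'S_4) :
  cross_ratio_hom (s * t)%g = (cross_ratio_hom s * cross_ratio_hom t)%g.
Proof.
apply/permP => j; rewrite permM !permE /cross_ratio_fun !permM.
by rewrite splitting_perm // (inj_eq perm_inj) neq_lift.
Qed.

Lemma one_line3 (s : 'S_3) : one_line s =
  [:: (val (s ord0)).+1; (val (s (lift ord0 ord0))).+1;
      (val (s (lift ord0 (lift ord0 ord0)))).+1].
Proof. by rewrite /one_line !enum_ordSl enum_ord0. Qed.

Lemma one_line4 (s : 'S_4) : one_line s =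
  [:: (val (s ord0)).+1; (val (s (lift ord0 ord0))).+1;
      (val (s (lift ord0 (lift ord0 ord0)))).+1;
      (val (s (lift ord0 (lift ord0 (lift ord0 ord0))))).+1].
Proof. by rewrite /one_line !enum_ordSl enum_ord0. Qed.

Lemma cross_ratio_hom_val (s : 'S_4) :
  [/\ one_line s = [:: 2; 1; 3; 4] -> one_line (cross_ratio_hom s) = [:: 1; 3; 2],
      one_line s = [:: 3; 2; 1; 4] -> one_line (cross_ratio_hom s) = [:: 3; 2; 1],
      one_line s = [:: 4; 2; 3; 1] -> one_line (cross_ratio_hom s) = [:: 2; 1; 3],
      one_line s = [:: 2; 4; 3; 1] -> one_line (cross_ratio_hom s) = [:: 2; 3; 1] &
      one_line s = [:: 3; 2; 4; 1] -> one_line (cross_ratio_hom s) = [:: 3; 1; 2]]%N.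
Proof.
rewrite one_line3 one_line4 !permE /cross_ratio_fun /splitting.
by split=> /= -[-> -> -> ->].
Qed.

Lemma cross_ratio_hom_ker (s : 'S_4) :
  cross_ratio_hom s = 1%g <->
  one_line s \in [:: [:: 1; 2; 3; 4]; [:: 2; 1; 4; 3];
                     [:: 4; 3; 2; 1]; [:: 3; 4; 1; 2]]%N.
Proof.
have uniq_s : uniq (one_line s).
  rewrite (map_inj_uniq (f := fun i => (val (s i)).+1)) ?enum_uniq //.
  by move=> i j [/val_inj /perm_inj].
have -> : (cross_ratio_hom s = 1%g) <->
    one_line (cross_ratio_hom s) = [:: 1; 2; 3]%N.
  split=> [->|]; first by rewrite one_line3 !perm1.
  rewrite one_line3 => -[e0 e1 e2]; apply/permP => i; rewrite perm1.
  have: i \in enum 'I_3 by rewrite mem_enum.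
  rewrite !enum_ordSl enum_ord0 !inE.
  by case/or3P => /eqP ->; apply: val_inj.
move: uniq_s; rewrite one_line3 one_line4 !permE /cross_ratio_fun.
case: (s _) (s _) (s _) (s _) => [[|[|[|[|//]]]] ?] [[|[|[|[|//]]]] ?]
  [[|[|[|[|//]]]] ?] [[|[|[|[|//]]]] ?] //=.
Qed.

Section Tuples.
Variable X : Type.

Definition nondegenerate (P : 4.-tuple X) : Prop := injective (tnth P).

Definition admissible (P : 4.-tuple X) : Prop :=
  forall x : X, (count (fun z => `[< z = x >]) P <= 2)%N.

Definition admissible5 (P : 5.-tuple X) : Prop :=
  forall i : 'I_5, admissible (delete_entry i P).

Definition scale_triple (alpha beta omega : X) : Prop :=
  injective (tnth [tuple alpha; beta; omega]).

End Tuples.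

Section SubMobius.
Variables (R : realType) (X : Type).

Definition coord_a (v : 3.-tuple (\bar R)) : \bar R := tnth v (@Ordinal 3 0 isT).
Definition coord_b (v : 3.-tuple (\bar R)) : \bar R := tnth v (@Ordinal 3 1 isT).
Definition coord_c (v : 3.-tuple (\bar R)) : \bar R := tnth v (@Ordinal 3 2 isT).

Definition L4 (v : 3.-tuple (\bar R)) : Prop :=
  exists a b c : R, a + b + c = 0 /\ v = [tuple a%:E; b%:E; c%:E].

Definition L4bar (v : 3.-tuple (\bar R)) : Prop :=
  [\/ L4 v, v = [tuple 0; +oo; -oo]%E, v = [tuple -oo; 0; +oo]%E |
      v = [tuple +oo; -oo; 0]%E].

Definition signed_triple (p : 'S_4) (v : 3.-tuple (\bar R)) : 3.-tuple (\bar R) :=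
  if odd_perm p then [tuple (- tnth v i)%E | i < 3] else v.

(* M is a total function; its values outside the admissible tuples are
   irrelevant. *)
Record sub_Mobius (M : 4.-tuple X -> 3.-tuple (\bar R)) : Prop := {
  sub_Mobius_L4bar : forall P, admissible P -> L4bar (M P);
  sub_Mobius_perm : forall (P : 4.-tuple X) (p : 'S_4), admissible P ->
    M (perm_tuple p P) = signed_triple p (perm_tuple (cross_ratio_hom p) (M P));
  sub_Mobius_nondeg : forall P, admissible P -> (L4 (M P) <-> nondegenerate P);
  sub_Mobius_deg : forall x1 x3 x4 : X, admissible [tuple x1; x1; x3; x4] ->
    M [tuple x1; x1; x3; x4] = [tuple 0; +oo; -oo]%E
}.

Definition infinitely_remote (d : X -> X -> \bar R) (w : X) : Prop :=
  forall x, x <> w -> d x w = +oo%E.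

(* The values -oo are excluded by positivity. *)
Record semi_metric (d : X -> X -> \bar R) : Prop := {
  semi_metric_sym : forall x y, d x y = d y x;
  semi_metric_pos : forall x y, x <> y -> (0 < d x y)%E;
  semi_metric_diag : forall x, d x x = 0%E;
  semi_metric_remote_uniq : forall w w',
    infinitely_remote d w -> infinitely_remote d w' -> w = w';
  semi_metric_remote : forall x y, d x y = +oo%E ->
    infinitely_remote d x \/ infinitely_remote d y
}.

Definition log_product (d : X -> X -> \bar R) (x y : X) : \bar R :=
  (- lne (d x y))%E.

(* The values a, b, c on a nondegenerate tuple. If one entry is the infinitely
   remote point, each of a, b, c has exactly two terms containing it, of opposite
   signs: both are dropped, since fine (-oo) = 0. *)
Definition Mobius_nondeg (d : X -> X -> \bar R) (x1 x2 x3 x4 : X) :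
    3.-tuple (\bar R) :=
  let p x y : R := fine (log_product d x y) in
  [tuple (p x1 x4 + p x2 x3 - p x1 x3 - p x2 x4)%:E;
         (p x1 x2 + p x3 x4 - p x1 x4 - p x2 x3)%:E;
         (p x2 x4 + p x1 x3 - p x1 x2 - p x3 x4)%:E].

(* On admissible tuples the three degenerate cases exclude each other. *)
Definition Mobius_of (d : X -> X -> \bar R) (P : 4.-tuple X) : 3.-tuple (\bar R) :=
  let x1 := tnth P (@Ordinal 4 0 isT) in
  let x2 := tnth P (@Ordinal 4 1 isT) in
  let x3 := tnth P (@Ordinal 4 2 isT) in
  let x4 := tnth P (@Ordinal 4 3 isT) in
  if `[< x1 = x2 \/ x3 = x4 >] then [tuple 0; +oo; -oo]%E
  else if `[< x1 = x3 \/ x2 = x4 >] then [tuple -oo; 0; +oo]%E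
  else if `[< x1 = x4 \/ x2 = x3 >] then [tuple +oo; -oo; 0]%E
  else Mobius_nondeg d x1 x2 x3 x4.

Definition is_Mobius (M : 4.-tuple X -> 3.-tuple (\bar R)) : Prop :=
  exists d : X -> X -> \bar R, semi_metric d /\
    forall P, admissible P -> M P = Mobius_of d P.

End SubMobius.

(* Main.v *)
Require Import Defs.
From mathcomp Require Import all_boot all_order all_fingroup all_algebra.
From mathcomp Require Import boolp reals ereal sequences exp.
From mathcomp Require Import ring lra.

(** Write (x|y) = - ln d(x,y). On a nondegenerate tuple the b-coordinate of M_d
  is (x1|x2) + (x3|x4) - (x1|x4) - (x2|x3), and (A) and (B) become identities
  in which all logarithms cancel. On admissible degenerate tuples a and b only
  take the values +oo, -oo, or the finite expression (which is then 0), and the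
  infinite values occur on both sides of (A) and (B) for the same tuples
  ([Mobius_of_a], [Mobius_of_b]).

  Conversely, equivariance under S_4 determines M on degenerate tuples
  ([sub_Mobius_degenerate]) and, on nondegenerate ones, expresses M through the
  single real function f = b o M, called [cross_diff] below. It remains to write
  f in the form f(x1,x2,x3,x4) = p(x1,x2) + p(x3,x4) - p(x1,x4) - p(x2,x3) with
  p symmetric ([has_potential_of_conditions]), for then d = exp (- p) is a
  semi-metric with M_d = M ([is_Mobius_of_potential]). Fix a scale triple
  (alpha, beta, omega), normalise p by p(., omega) = 0 and p(alpha, beta) = 0;
  these choices amount to sending omega to infinity and scaling
  d(alpha, beta) = 1. The formula for f then forces
      p(x, alpha) = f(x, alpha, beta, omega),
      p(x, y) = f(x, y, alpha, omega) + p(y, alpha).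
  Condition (B) for this one scale triple says that p is symmetric. Condition
  (A) for the triples (alpha, z, omega) replaces alpha by an arbitrary z and
  gives f(x, y, z, omega) = p(x, y) - p(y, z). Finally (A) with x = omega, and
  thus with omega in the role of a variable point, expresses a difference of two
  values of f at tuples avoiding omega by values at tuples containing it; by the
  relation a + b + c = 0 that difference is again a value of f, at an arbitrary
  tuple avoiding omega.

  If X has no scale triple then it has at most two points, all admissible
  tuples are degenerate, and any semi-metric will do. *)

Set Implicit Arguments.
Unset Strict Implicit.
Unset Printing Implicit Defensive.
Import Order.TTheory GRing.Theory Num.Theory.

Local Open Scope ring_scope.

(** * Tuples with few coincidences *)

Section Tuples.
Variable X : Type.
Implicit Types x y z w : X.

Definition distinct4 x1 x2 x3 x4 : Prop :=
  [/\ x1 <> x2, x1 <> x3, x1 <> x4 & [/\ x2 <> x3, x2 <> x4 & x3 <> x4]].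

Lemma tuple4_destruct (P : 4.-tuple X) :
  exists x1 x2 x3 x4 : X, P = [tuple x1; x2; x3; x4].
Proof.
exists (tnth P (inord 0)), (tnth P (inord 1)), (tnth P (inord 2)).
exists (tnth P (inord 3)); apply: eq_from_tnth => -[[|[|[|[|//]]]] lt_i];
  by rewrite [RHS](tnth_nth (tnth P ord0)) /=; congr tnth; apply: val_inj;
  rewrite /= inordK.
Qed.

Lemma admissible4 x1 x2 x3 x4 :
  admissible [tuple x1; x2; x3; x4] <->
  [/\ ~ (x1 = x2 /\ x1 = x3), ~ (x1 = x2 /\ x1 = x4),
      ~ (x1 = x3 /\ x1 = x4) & ~ (x2 = x3 /\ x2 = x4)].
Proof.
split=> [adm | [n123 n124 n134 n234] x /=].
  split=> -[e1 e2]; subst; [move: (adm x3)|move: (adm x4)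
    |move: (adm x4)|move: (adm x4)]; rewrite /= !(asboolT erefl);
    by case: asboolP.
do 4!case: asboolP => ? //=; subst; exfalso; tauto.
Qed.

Lemma nondegenerate4 x1 x2 x3 x4 :
  Defs.nondegenerate [tuple x1; x2; x3; x4] <-> distinct4 x1 x2 x3 x4.
Proof.
split=> [inj | [n12 n13 n14 [n23 n24 n34]]].
  have neq (i j : 'I_4) : i != j ->
      tnth [tuple x1; x2; x3; x4] i <> tnth [tuple x1; x2; x3; x4] j.
    by move=> /eqP nij /inj.
  split; [exact: (neq (@Ordinal 4 0 isT) (@Ordinal 4 1 isT))
         |exact: (neq (@Ordinal 4 0 isT) (@Ordinal 4 2 isT))
         |exact: (neq (@Ordinal 4 0 isT) (@Ordinal 4 3 isT))|].
  split; [exact: (neq (@Ordinal 4 1 isT) (@Ordinal 4 2 isT))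
         |exact: (neq (@Ordinal 4 1 isT) (@Ordinal 4 3 isT))
         |exact: (neq (@Ordinal 4 2 isT) (@Ordinal 4 3 isT))].
move=> [[|[|[|[|//]]]] ?] [[|[|[|[|//]]]] ?]; rewrite /tnth /= => e;
  by [apply: val_inj | exfalso; move: e; first [done | exact: nesym]].
Qed.

Lemma scale_triple3 x y z :
  scale_triple x y z <-> [/\ x <> y, x <> z & y <> z].
Proof.
split=> [inj | [nxy nxz nyz]].
  have neq (i j : 'I_3) : i != j ->
      tnth [tuple x; y; z] i <> tnth [tuple x; y; z] j.
    by move=> /eqP nij /inj.
  split; [exact: (neq (@Ordinal 3 0 isT) (@Ordinal 3 1 isT))
         |exact: (neq (@Ordinal 3 0 isT) (@Ordinal 3 2 isT))
         |exact: (neq (@Ordinal 3 1 isT) (@Ordinal 3 2 isT))].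
move=> [[|[|[|//]]] ?] [[|[|[|//]]] ?]; rewrite /tnth /= => e;
  by [apply: val_inj | exfalso; move: e; first [done | exact: nesym]].
Qed.

Lemma admissible5E x1 x2 x3 x4 x5 :
  admissible5 [tuple x1; x2; x3; x4; x5] <->
  [/\ admissible [tuple x2; x3; x4; x5], admissible [tuple x1; x3; x4; x5],
      admissible [tuple x1; x2; x4; x5], admissible [tuple x1; x2; x3; x5] &
      admissible [tuple x1; x2; x3; x4]].
Proof.
have del (i : 'I_5) : delete_entry i [tuple x1; x2; x3; x4; x5] =
    nth [tuple x1; x2; x3; x4]
      [:: [tuple x2; x3; x4; x5]; [tuple x1; x3; x4; x5];
          [tuple x1; x2; x4; x5]; [tuple x1; x2; x3; x5]] i.
  apply: eq_from_tnth => j; rewrite tnth_mktuple.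
  by case: i j => [[|[|[|[|[|//]]]]] ?] [[|[|[|[|//]]]] ?].
split=> [adm | [a1 a2 a3 a4 a5] i].
  by split; [have := adm (@Ordinal 5 0 isT)|have := adm (@Ordinal 5 1 isT)
    |have := adm (@Ordinal 5 2 isT)|have := adm (@Ordinal 5 3 isT)
    |have := adm (@Ordinal 5 4 isT)]; rewrite del.
by rewrite del; case: i => [[|[|[|[|[|//]]]]] lti].
Qed.

Lemma distinct4_admissible x1 x2 x3 x4 :
  distinct4 x1 x2 x3 x4 -> admissible [tuple x1; x2; x3; x4].
Proof. by case=> ? ? ? [? ? ?]; apply/admissible4; split=> -[]. Qed.

Lemma distinct5_admissible x y a b w :
  distinct4 x y a b -> distinct4 x y a w -> b <> w ->
  scale_triple a b w /\ admissible5 [tuple x; y; a; b; w].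
Proof.
move=> [? ? ? [? ? ?]] [_ _ ? [_ ? ?]] ?; split; first exact/scale_triple3.
by apply/admissible5E; split; apply: distinct4_admissible.
Qed.

End Tuples.

Section SubMobius.
Variables (R : realType) (X : Type).
Implicit Types x y z w : X.

Lemma Mobius_ofE (d : X -> X -> \bar R) x1 x2 x3 x4 :
  Mobius_of d [tuple x1; x2; x3; x4] =
  if `[< x1 = x2 \/ x3 = x4 >] then [tuple (0 : \bar R); +oo; -oo]%E
  else if `[< x1 = x3 \/ x2 = x4 >] then [tuple -oo; (0 : \bar R); +oo]%E
  else if `[< x1 = x4 \/ x2 = x3 >] then [tuple +oo; -oo; (0 : \bar R)]%E
  else Mobius_nondeg d x1 x2 x3 x4.
Proof. by rewrite /Mobius_of; do 3!case: ifP => // _. Qed.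

(** * Consequences of equivariance under S_4 *)

Section Symmetry.
Variable M : 4.-tuple X -> 3.-tuple (\bar R).
Hypothesis hM : sub_Mobius M.

(** A transposition is odd, hence always contributes the minus sign. *)
Lemma sub_Mobius_tperm (i j : 'I_4) P P' : i != j -> admissible P ->
  (forall k, tnth P' k = tnth P (tperm i j k)) ->
  M P' = [tuple (- tnth (M P) (cross_ratio_fun (tperm i j) k))%E | k < 3].
Proof.
move=> nij adm PP'; have -> : P' = perm_tuple (tperm i j) P.
  by apply: eq_from_tnth => k; rewrite tnth_mktuple.
rewrite (sub_Mobius_perm hM _ adm) /signed_triple odd_tperm nij.
by apply: eq_from_tnth => k; rewrite !tnth_mktuple permE.
Qed.

Ltac swap_entries i j :=
  let adm := fresh "adm" in let k := fresh "k" in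
  move=> adm; rewrite (@sub_Mobius_tperm i j _ _ isT adm) => [|k];
  [ apply: eq_from_tnth => k; rewrite tnth_mktuple /cross_ratio_fun !permE;
    case: k => [[|[|[|//]]] ?]; congr (- tnth _ _)%E; exact: val_inj
  | by rewrite permE; case: k => [[|[|[|[|//]]]] ?] ].

Lemma sub_Mobius_swap12 x1 x2 x3 x4 (v := M [tuple x1; x2; x3; x4]) :
  admissible [tuple x1; x2; x3; x4] ->
  M [tuple x2; x1; x3; x4] =
    [tuple - coord_a v; - coord_c v; - coord_b v]%E.
Proof. swap_entries (@Ordinal 4 0 isT) (@Ordinal 4 1 isT). Qed.

Lemma sub_Mobius_swap34 x1 x2 x3 x4 (v := M [tuple x1; x2; x3; x4]) :
  admissible [tuple x1; x2; x3; x4] ->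
  M [tuple x1; x2; x4; x3] =
    [tuple - coord_a v; - coord_c v; - coord_b v]%E.
Proof. swap_entries (@Ordinal 4 2 isT) (@Ordinal 4 3 isT). Qed.

Lemma sub_Mobius_swap23 x1 x2 x3 x4 (v := M [tuple x1; x2; x3; x4]) :
  admissible [tuple x1; x2; x3; x4] ->
  M [tuple x1; x3; x2; x4] =
    [tuple - coord_b v; - coord_a v; - coord_c v]%E.
Proof. swap_entries (@Ordinal 4 1 isT) (@Ordinal 4 2 isT). Qed.

Lemma sub_Mobius_swap14 x1 x2 x3 x4 (v := M [tuple x1; x2; x3; x4]) :
  admissible [tuple x1; x2; x3; x4] ->
  M [tuple x4; x2; x3; x1] =
    [tuple - coord_b v; - coord_a v; - coord_c v]%E.
Proof. swap_entries (@Ordinal 4 0 isT) (@Ordinal 4 3 isT). Qed.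

Lemma sub_Mobius_swap13 x1 x2 x3 x4 (v := M [tuple x1; x2; x3; x4]) :
  admissible [tuple x1; x2; x3; x4] ->
  M [tuple x3; x2; x1; x4] =
    [tuple - coord_c v; - coord_b v; - coord_a v]%E.
Proof. swap_entries (@Ordinal 4 0 isT) (@Ordinal 4 2 isT). Qed.

Lemma triple_eta (v : 3.-tuple (\bar R)) :
  v = [tuple coord_a v; coord_b v; coord_c v].
Proof.
apply: eq_from_tnth => -[[|[|[|//]]] ?]; rewrite [RHS]/tnth /=;
  congr tnth; exact: val_inj.
Qed.

Ltac reorder_admissible :=
  match goal with adm : admissible _ |- _ =>
    apply admissible4 in adm; apply admissible4; destruct adm;
    split; intros [? ?]; subst; tauto
  end.

(** This permutation and the next one lie in the Klein group, the kernel of the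
  cross-ratio homomorphism: they are products of two transpositions with the
  same image in S_3, so that both the permutation and the sign cancel. *)
Lemma sub_Mobius_2143 x1 x2 x3 x4 : admissible [tuple x1; x2; x3; x4] ->
  M [tuple x2; x1; x4; x3] = M [tuple x1; x2; x3; x4].
Proof.
move=> adm; rewrite sub_Mobius_swap34; last by reorder_admissible.
rewrite sub_Mobius_swap12 // [RHS]triple_eta /coord_a /coord_b /coord_c.
by rewrite /tnth /= !oppeK.
Qed.

Lemma sub_Mobius_4321 x1 x2 x3 x4 : admissible [tuple x1; x2; x3; x4] ->
  M [tuple x4; x3; x2; x1] = M [tuple x1; x2; x3; x4].
Proof.
move=> adm; rewrite sub_Mobius_swap23; last by reorder_admissible.
rewrite sub_Mobius_swap14 // [RHS]triple_eta /coord_a /coord_b /coord_c.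
by rewrite /tnth /= !oppeK.
Qed.

(** Every admissible tuple with a repeated entry is a permutation of one of the
  form (x, x, y, z), where the axioms prescribe the value. *)
Lemma sub_Mobius_degenerate (d : X -> X -> \bar R) x1 x2 x3 x4 :
  admissible [tuple x1; x2; x3; x4] -> ~ distinct4 x1 x2 x3 x4 ->
  M [tuple x1; x2; x3; x4] = Mobius_of d [tuple x1; x2; x3; x4].
Proof.
have M12 x y z : admissible [tuple x; x; y; z] ->
    M [tuple x; x; y; z] = [tuple (0 : \bar R); +oo; -oo]%E.
  by move=> adm; rewrite (sub_Mobius_deg hM adm); apply: val_inj.
have M13 x y z : admissible [tuple x; y; x; z] ->
    M [tuple x; y; x; z] = [tuple -oo; (0 : \bar R); +oo]%E.
  move=> adm.
  have adm' : admissible [tuple x; x; y; z] by reorder_admissible.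
  rewrite sub_Mobius_swap23 // M12 // /coord_a /coord_b /coord_c.
  by rewrite /tnth /= oppr0.
have M23 x y z : admissible [tuple z; x; x; y] ->
    M [tuple z; x; x; y] = [tuple +oo; -oo; (0 : \bar R)]%E.
  move=> adm.
  have adm' : admissible [tuple x; z; x; y] by reorder_admissible.
  rewrite sub_Mobius_swap12 // M13 // /coord_a /coord_b /coord_c.
  by rewrite /tnth /= oppr0.
move=> adm deg; rewrite Mobius_ofE.
case: asboolP => [[e|e]|n1].
- by subst; exact: M12.
- by subst; rewrite -sub_Mobius_4321 // M12 //; reorder_admissible.
case: asboolP => [[e|e]|n2].
- by subst; exact: M13.
- by subst; rewrite -sub_Mobius_2143 // M13 //; reorder_admissible.
case: asboolP => [[e|e]|n3].
- by subst; rewrite -sub_Mobius_2143 // M23 //; reorder_admissible.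
- by subst; exact: M23.
by case: deg; split; [| | |split]; tauto.
Qed.

(** The b-coordinate; it is finite on tuples of distinct points, and [fine]
  makes it real-valued everywhere. *)
Definition cross_diff (x1 x2 x3 x4 : X) : R :=
  fine (coord_b (M [tuple x1; x2; x3; x4])).

(** Swapping the middle entries exchanges a and b up to sign, swapping the first
  two exchanges b and c up to sign: b alone carries all of M. *)
Lemma sub_Mobius_cross_diff x1 x2 x3 x4 : distinct4 x1 x2 x3 x4 ->
  M [tuple x1; x2; x3; x4] = [tuple (- cross_diff x1 x3 x2 x4)%:E;
    (cross_diff x1 x2 x3 x4)%:E; (- cross_diff x2 x1 x3 x4)%:E].
Proof.
move=> dist; have adm := distinct4_admissible dist.
have [a [b [c [_ Mabc]]]] : L4 (M [tuple x1; x2; x3; x4]).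
  by apply/(sub_Mobius_nondeg hM adm)/nondegenerate4.
rewrite /cross_diff (sub_Mobius_swap23 adm) (sub_Mobius_swap12 adm) Mabc.
by rewrite /coord_a /coord_b /coord_c /tnth /= !opprK.
Qed.

(** The relation a + b + c = 0. *)
Lemma cross_diff_split x1 x2 x3 x4 : distinct4 x1 x2 x3 x4 ->
  cross_diff x1 x2 x3 x4 = cross_diff x1 x3 x2 x4 + cross_diff x2 x1 x3 x4.
Proof.
move=> dist; have adm := distinct4_admissible dist.
have [a [b [c [abc Mabc]]]] : L4 (M [tuple x1; x2; x3; x4]).
  by apply/(sub_Mobius_nondeg hM adm)/nondegenerate4.
rewrite /cross_diff (sub_Mobius_swap23 adm) (sub_Mobius_swap12 adm) Mabc.
by rewrite /coord_a /coord_b /coord_c /tnth /=; lra.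
Qed.

Lemma cross_diff_swap13 x1 x2 x3 x4 : distinct4 x1 x2 x3 x4 ->
  cross_diff x3 x2 x1 x4 = - cross_diff x1 x2 x3 x4.
Proof.
move=> dist; have adm := distinct4_admissible dist.
by rewrite /cross_diff (sub_Mobius_swap13 adm) -fineN.
Qed.

Lemma cross_diff_2143 x1 x2 x3 x4 : distinct4 x1 x2 x3 x4 ->
  cross_diff x2 x1 x4 x3 = cross_diff x1 x2 x3 x4.
Proof.
move=> dist; rewrite /cross_diff.
by rewrite (sub_Mobius_2143 (distinct4_admissible dist)).
Qed.

Lemma cross_diff_4321 x1 x2 x3 x4 : distinct4 x1 x2 x3 x4 ->
  cross_diff x4 x3 x2 x1 = cross_diff x1 x2 x3 x4.
Proof.
move=> dist; rewrite /cross_diff.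
by rewrite (sub_Mobius_4321 (distinct4_admissible dist)).
Qed.

End Symmetry.

(** * Construction of the potential *)

(** p plays the role of - ln d for a semi-metric d with remote point w0, the
  terms containing w0 being dropped. *)
Definition has_potential (f : X -> X -> X -> X -> R) (w0 : X) : Prop :=
  exists p : X -> X -> R,
  [/\ forall x y, x <> y -> p x y = p y x, forall x, p x w0 = 0 &
    forall x1 x2 x3 x4, distinct4 x1 x2 x3 x4 ->
      f x1 x2 x3 x4 = p x1 x2 + p x3 x4 - p x1 x4 - p x2 x3].

Section Potential.
Variables (f : X -> X -> X -> X -> R) (alpha beta omega : X).
Hypothesis f_split : forall x1 x2 x3 x4, distinct4 x1 x2 x3 x4 ->
  f x1 x2 x3 x4 = f x1 x3 x2 x4 + f x2 x1 x3 x4.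
Hypothesis f_swap13 : forall x1 x2 x3 x4, distinct4 x1 x2 x3 x4 ->
  f x3 x2 x1 x4 = - f x1 x2 x3 x4.
Hypothesis f_2143 : forall x1 x2 x3 x4, distinct4 x1 x2 x3 x4 ->
  f x2 x1 x4 x3 = f x1 x2 x3 x4.
Hypothesis f_4321 : forall x1 x2 x3 x4, distinct4 x1 x2 x3 x4 ->
  f x4 x3 x2 x1 = f x1 x2 x3 x4.
Hypothesis f_A : forall x y a b w,
  distinct4 x y a b -> distinct4 x y a w -> b <> w ->
  f y a b w + f x y a w = f x y b w + f y b a w.
Hypothesis f_B : forall x y a b w,
  distinct4 x y a b -> distinct4 x y a w -> b <> w ->
  f x a b w = f x a y w + f y a b w.
Hypotheses (nab : alpha <> beta) (naw : alpha <> omega) (nbw : beta <> omega).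

(** q is p(., alpha) away from alpha and omega; at beta the tuple
  (x, alpha, beta, omega) is degenerate and the normalisation decides. *)
Let q x := if `[< x = beta >] then 0 else f x alpha beta omega.
Let p x y :=
  if `[< x = omega \/ y = omega >] then 0
  else if `[< x = alpha >] then q y else if `[< y = alpha >] then q x
  else f x y alpha omega + q y.

Ltac distinct :=
  repeat match goal with dist : distinct4 _ _ _ _ |- _ =>
    destruct dist as [? ? ? [? ? ?]]
  end;
  first [congruence
    | split; [congruence|congruence|congruence|split; congruence]].

Let q_beta : q beta = 0.
Proof. by rewrite /q asboolT. Qed.

Let qE x : x <> beta -> q x = f x alpha beta omega.
Proof. by move=> nxb; rewrite /q asboolF. Qed.

Let p_omega x : p x omega = 0.
Proof. by rewrite /p asboolT //; right. Qed.

Let p_omegal x : p omega x = 0.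
Proof. by rewrite /p asboolT //; left. Qed.

Let p_alphal y : y <> omega -> p alpha y = q y.
Proof. by move=> nyw; rewrite /p asboolF ?asboolT //; tauto. Qed.

Let p_alpha x : x <> omega -> p x alpha = q x.
Proof.
move=> nxw; rewrite /p asboolF; last tauto.
by case: asboolP => [->//|_]; rewrite asboolT.
Qed.

Let pE x y : distinct4 x y alpha omega ->
  p x y = f x y alpha omega + q y.
Proof. by case=> ? ? ? [? ? _]; rewrite /p !asboolF //; tauto. Qed.

(** Symmetry of p is condition (B), in which f(x, alpha, y, omega) is the
  difference f(x, y, alpha, omega) - f(y, x, alpha, omega). When x or y is beta,
  (B) is not available and [f_split] alone suffices. *)
Let pC x y : x <> y -> p x y = p y x.
Proof.
move=> nxy.
case: (pselect (x = omega)) => [->|nxw]; first by rewrite p_omega p_omegal.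
case: (pselect (y = omega)) => [->|nyw]; first by rewrite p_omega p_omegal.
case: (pselect (x = alpha)) => [->|nxa]; first by rewrite p_alpha ?p_alphal.
case: (pselect (y = alpha)) => [->|nya]; first by rewrite p_alpha ?p_alphal.
have dxy : distinct4 x y alpha omega by distinct.
have dyx : distinct4 y x alpha omega by distinct.
rewrite !pE //; case: (pselect (x = beta)) => [xb|nxb].
  subst x; rewrite q_beta addr0 (f_split dyx) qE; last exact: nesym.
  by rewrite addrC.
case: (pselect (y = beta)) => [yb|nyb].
  by subst y; rewrite q_beta addr0 (f_split dxy) qE // addrC.
rewrite !qE // (f_split dxy) (@f_B x y alpha beta omega) //; ring.
Qed.

Let f_alpha_omega x y : distinct4 x y alpha omega ->
  f x y alpha omega = p x y - p y alpha.
Proof.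
move=> dist; rewrite pE // p_alpha ?addrK //.
by case: dist => _ _ _ [].
Qed.

(** Condition (A) for the triple (alpha, z, omega) moves the third argument
  from alpha to z; tuples that contain alpha are reduced by [f_split] and
  permutations to those with alpha in the third place. *)
Let f_omega x y z : distinct4 x y z omega ->
  f x y z omega = p x y - p y z.
Proof.
move=> dist; have [nxy nxz nxw [nyz nyw nzw]] := dist.
have f_mid u v : distinct4 u alpha v omega ->
    f u alpha v omega = p u alpha - p alpha v.
  move=> duv; have [nua nuv nuw [nav _ nvw]] := duv.
  rewrite f_split // (@f_swap13 v u alpha); last distinct.
  rewrite !f_alpha_omega; try distinct.
  rewrite (pC nuv) (pC nav); ring.
case: (pselect (z = alpha)) => [za|nza]; first by subst; exact: f_alpha_omega.
case: (pselect (y = alpha)) => [ya|nya]; first by subst; exact: f_mid.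
case: (pselect (x = alpha)) => [xa|nxa].
  subst; rewrite -[LHS]opprK -f_swap13 // f_alpha_omega; last by distinct.
  by rewrite (@pC y z) // (@pC y alpha) //; lra.
have := @f_A x y alpha z omega; rewrite f_mid; last by distinct.
rewrite !f_alpha_omega; try distinct.
rewrite (@pC alpha z); last exact: nesym.
move=> A; have {}A : p y alpha - p z alpha + (p x y - p y alpha) =
  f x y z omega + (p y z - p z alpha) by apply: A; distinct.
lra.
Qed.

(** Condition (A) at (omega, x2, x1, x3, x4): after reversal by [f_4321] two of
  its terms have omega in the last place, and by [f_split] the other two differ
  by f(x1, x2, x3, x4). *)
Let f_no_omega x1 x2 x3 x4 : distinct4 x1 x2 x3 x4 ->
  x1 <> omega -> x2 <> omega -> x3 <> omega -> x4 <> omega ->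
  f x1 x2 x3 x4 = p x1 x2 + p x3 x4 - p x1 x4 - p x2 x3.
Proof.
move=> dist n1 n2 n3 n4; have [n12 n13 n14 [n23 n24 n34]] := dist.
have := @f_A omega x2 x1 x3 x4.
rewrite (@f_4321 x4 x1 x2 omega) ?(@f_4321 x4 x3 x2 omega); try distinct.
rewrite !f_omega; try distinct.
move=> A; have {}A : f x2 x1 x3 x4 + (p x4 x1 - p x1 x2) =
  p x4 x3 - p x3 x2 + f x2 x3 x1 x4 by apply: A; distinct.
have split2 : f x2 x1 x3 x4 = f x2 x3 x1 x4 + f x1 x2 x3 x4.
  by apply: f_split; distinct.
rewrite (@pC x3 x4) // (@pC x1 x4) // (@pC x2 x3) //; lra.
Qed.

(** A tuple containing omega has, by the Klein group, a rearrangement with the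
  same value of f and omega in the last place. *)
Lemma has_potential_of_conditions : has_potential f omega.
Proof.
exists p; split=> // x1 x2 x3 x4 dist.
have [n12 n13 n14 [n23 n24 n34]] := dist.
case: (pselect (x4 = omega)) => [e4|n4].
  by subst; rewrite f_omega // !p_omega; ring.
case: (pselect (x3 = omega)) => [e3|n3].
  subst x3; rewrite -f_2143 // f_omega; last distinct.
  by rewrite p_omega p_omegal (@pC x2 x1) ?(@pC x4 x1); try ring; exact: nesym.
case: (pselect (x2 = omega)) => [e2|n2].
  subst x2; rewrite -f_2143 // -f_4321; last distinct.
  rewrite f_omega; last distinct.
  by rewrite p_omega p_omegal (@pC x4 x1) //; try ring; exact: nesym.
case: (pselect (x1 = omega)) => [e1|n1]; last exact: f_no_omega.
subst x1; rewrite -f_4321 // f_omega; last distinct.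
by rewrite !p_omegal (@pC x4 x3) ?(@pC x3 x2) //; try ring; exact: nesym.
Qed.

End Potential.

(** * From potentials to semi-metrics *)

Section SemiMetrics.
Variable M : 4.-tuple X -> 3.-tuple (\bar R).
Hypothesis hM : sub_Mobius M.

(** The discrete metric works: all admissible tuples are degenerate. *)
Lemma is_Mobius_no_scale_triple :
  (forall alpha beta omega : X, ~ scale_triple alpha beta omega) ->
  is_Mobius M.
Proof.
move=> no_triple; pose d x y : \bar R := if `[< x = y >] then 0%E else 1%E.
have dE x y : d x y = if `[< x = y >] then 0%E else 1%E by [].
have not_remote w w' : w <> w' -> ~ infinitely_remote d w.
  by move=> nww' /(_ w' (nesym nww')); rewrite dE; case: asboolP.
exists d; split.
  split.
  - by move=> x y; rewrite !dE; congr (if _ then _ else _);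
      apply/asboolP/asboolP.
  - by move=> x y nxy; rewrite dE asboolF // lte01.
  - by move=> x; rewrite dE asboolT.
  - move=> w w' rw _; case: (pselect (w = w')) => // nww'.
    by case: (not_remote w w').
  - by move=> x y; rewrite dE; case: asboolP.
move=> P; have [x1 [x2 [x3 [x4 ->]]]] := tuple4_destruct P => adm.
apply: sub_Mobius_degenerate => // -[? ? _ [? _ _]].
by case: (no_triple x1 x2 x3); apply/scale_triple3.
Qed.

(** d = exp (- p), with omega moved to infinity. The points alpha and beta
  guarantee that omega is the only remote point: any other w is at finite
  distance from alpha or from beta. *)
Lemma is_Mobius_of_potential alpha beta omega :
  alpha <> beta -> alpha <> omega -> beta <> omega ->
  has_potential (cross_diff M) omega -> is_Mobius M.
Proof.
move=> nab naw nbw [p [pC p_omega cdE]].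
pose d x y : \bar R := if `[< x = y >] then 0%E else
  if `[< x = omega \/ y = omega >] then +oo%E else (expR (- p x y))%:E.
have d_diag x : d x x = 0%E by rewrite /d asboolT.
have d_omega x y : x <> y -> x = omega \/ y = omega -> d x y = +oo%E.
  by move=> nxy xyw; rewrite /d asboolF // asboolT.
have d_fin x y : x <> y -> x <> omega -> y <> omega ->
    d x y = (expR (- p x y))%:E.
  by move=> nxy nxw nyw; rewrite /d !asboolF //; tauto.
have cases x y : [\/ x = y, x <> y /\ (x = omega \/ y = omega) |
    [/\ x <> y, x <> omega & y <> omega]].
  case: (pselect (x = y)); case: (pselect (x = omega \/ y = omega)) => ? ?;
    try by [apply: Or31|apply: Or32].
  by apply: Or33; split=> //; tauto.
have dC x y : d x y = d y x.
  case: (cases x y) => [->//|[nxy xyw]|[nxy nx ny]].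
    by rewrite !d_omega //; [exact: nesym | tauto].
  by rewrite (d_fin _ _ nxy nx ny) (d_fin _ _ (nesym nxy) ny nx) pC.
(* From here on d is used only through the facts above; keeping it opaque stops
   conversion from unfolding the exponential. *)
clearbody d.
have remoteE w : infinitely_remote d w -> w = omega.
  move=> rw; case: (pselect (w = omega)) => // nw; exfalso.
  have [z [nzw nzo]] : exists z, z <> w /\ z <> omega.
    case: (pselect (w = alpha)) => [->|nwa].
      by exists beta; split=> //; exact: nesym.
    by exists alpha; split=> //; exact: nesym.
  by have := rw z nzw; rewrite d_fin.
have dist_log x y : x <> y -> fine (log_product d x y) = p x y.
  move=> nxy; rewrite /log_product.
  case: (cases x y) => [//|[_ xyw]|[_ nx ny]].
    by rewrite d_omega //=; case: xyw => e; subst; [rewrite pC|];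
      rewrite ?p_omega.
  by rewrite (d_fin _ _ nxy nx ny) (lne_EFin (expR_gt0 _)) expRK /= opprK.
exists d; split.
  split=> //.
  - move=> x y nxy; case: (cases x y) => [//|[_ xyw]|[_ nx ny]].
      by rewrite d_omega.
    by rewrite (d_fin _ _ nxy nx ny) lte_fin expR_gt0.
  - by move=> w w' /remoteE -> /remoteE ->.
  - move=> x y; case: (cases x y) => [->|[nxy xyw]|[nxy nx ny]].
    + by rewrite d_diag.
    + case: xyw => [->|->] _; [left|right] => z nz;
        by apply: d_omega => //; right.
    + by rewrite d_fin.
move=> P; have [x1 [x2 [x3 [x4 ->]]]] := tuple4_destruct P => adm.
case: (pselect (distinct4 x1 x2 x3 x4)) => [dist|]; last first.
  exact: sub_Mobius_degenerate.
have [n12 n13 n14 [n23 n24 n34]] := dist.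
rewrite sub_Mobius_cross_diff // Mobius_ofE !asboolF; try tauto.
rewrite /Mobius_nondeg !dist_log //.
have -> : cross_diff M x1 x3 x2 x4 = p x1 x3 + p x2 x4 - p x1 x4 - p x3 x2.
  by apply: cdE; split=> //; split=> //; exact: nesym.
have -> : cross_diff M x2 x1 x3 x4 = p x2 x1 + p x3 x4 - p x2 x4 - p x1 x3.
  by apply: cdE; split=> //; exact: nesym.
rewrite cdE // (pC _ _ (nesym n12)) (pC _ _ (nesym n23)).
by congr [tuple _%:E; _; _%:E]; ring.
Qed.

End SemiMetrics.

(** * The coordinates of the structure of a semi-metric *)

Section MobiusCoordinates.
Variable d : X -> X -> \bar R.
Hypothesis dC : forall x y, d x y = d y x.
Let p x y : R := fine (log_product d x y).

Let pC x y : p x y = p y x.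
Proof. by rewrite /p /log_product dC. Qed.

(** If x1 = x3 or x2 = x4 then b = 0, which by symmetry is also the value of the
  finite expression; so only two of the three kinds of degeneracy show. *)
Lemma Mobius_of_b x1 x2 x3 x4 : admissible [tuple x1; x2; x3; x4] ->
  coord_b (Mobius_of d [tuple x1; x2; x3; x4]) =
    if `[< x1 = x2 \/ x3 = x4 >] then +oo%E
    else if `[< x1 = x4 \/ x2 = x3 >] then -oo%E
    else (p x1 x2 + p x3 x4 - p x1 x4 - p x2 x3)%:E.
Proof.
case/admissible4 => n1 n2 n3 n4; rewrite Mobius_ofE.
case: asboolP => // n12; case: asboolP => [e13|n13]; last by case: asboolP.
rewrite asboolF; last by case: e13 => e13; subst; intuition.
rewrite /coord_b /tnth /=; congr _%:E.
by case: e13 => ->; [rewrite (pC x3 x2)|rewrite (pC x4 x3)]; ring.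
Qed.

(** As for b, with x1 = x2 or x3 = x4 the case where the value is 0. *)
Lemma Mobius_of_a x1 x2 x3 x4 : admissible [tuple x1; x2; x3; x4] ->
  coord_a (Mobius_of d [tuple x1; x2; x3; x4]) =
    if `[< x1 = x3 \/ x2 = x4 >] then -oo%E
    else if `[< x1 = x4 \/ x2 = x3 >] then +oo%E
    else (p x1 x4 + p x2 x3 - p x1 x3 - p x2 x4)%:E.
Proof.
case/admissible4 => n1 n2 n3 n4; rewrite Mobius_ofE.
case: asboolP => [e12|n12]; last first.
  by case: asboolP => // _; case: asboolP.
rewrite !asboolF; try by case: e12 => e12; subst; intuition.
rewrite /coord_a /tnth /=; congr _%:E.
by case: e12 => ->; ring.
Qed.

End MobiusCoordinates.
End SubMobius.

Theorem theorem3p5 (R : realType) (X : Type)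
    (M : 4.-tuple X -> 3.-tuple (\bar R)) (hM : sub_Mobius M) :
  is_Mobius M <->
  (forall alpha beta omega : X, scale_triple alpha beta omega ->
   forall x y : X, admissible5 [tuple x; y; alpha; beta; omega] ->
   let P1 := [tuple y; alpha; beta; omega] in
   let P2 := [tuple x; alpha; beta; omega] in
   let P3 := [tuple x; y; beta; omega] in
   let P4 := [tuple x; y; alpha; omega] in
   (y <> alpha -> y <> beta ->
      (coord_b (M P1) + coord_b (M P4) = coord_b (M P3) - coord_a (M P1))%E) /\
   (y <> alpha -> y <> omega ->
      (coord_b (M P2) = - coord_a (M P4) + coord_b (M P1))%E)).
Proof.
split=> [[d [dsm Md]] alpha beta omega /scale_triple3[nab naw nbw] x y|AB].
  move=> /admissible5E[a1 a2 a3 a4 _] /=.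
  have dC := semi_metric_sym dsm.
  rewrite !Md // !(@Mobius_of_b _ _ d) // !Mobius_of_a //.
  have orF (P Q : Prop) : ~ Q -> `[< P \/ Q >] = `[< P >].
    by move=> nQ; congr asbool; apply/propext; tauto.
  rewrite !(orF _ _ nab) !(orF _ _ naw) !(orF _ _ nbw).
  (* Pruning the coincidences excluded by the hypotheses leaves the same tests
     on both sides. *)
  split=> [nya nyb|nya nyw].
    rewrite !(orF _ _ nya) !(orF _ _ nyb) !(asboolF nya) !(asboolF nyb).
    case: (asboolP (y = omega)) => [yw|nyw].
      have /admissible4[_ nxyw _ _] := a4.
      by rewrite !asboolF // => ?; apply: nxyw; subst.
    case: (asboolP (x = y)) => // _; case: (asboolP (x = omega)) => // _.
    by rewrite -EFinN -!EFinD; congr _%:E; ring.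
  rewrite !(orF _ _ nya) !(orF _ _ nyw) !(asboolF nya) !(asboolF nyw).
  case: (asboolP (x = alpha)) => // _; case: (asboolP (x = omega)) => // _.
  by rewrite -EFinN -!EFinD; congr _%:E; ring.
case: (pselect (exists a b w : X, scale_triple a b w)); last first.
  move=> no_triple; apply: is_Mobius_no_scale_triple => // a b w abw.
  by apply: no_triple; exists a, b, w.
move=> [alpha [beta [omega /scale_triple3[nab naw nbw]]]].
apply: (@is_Mobius_of_potential _ _ M hM alpha beta omega) => //.
apply: (@has_potential_of_conditions _ _ _ alpha beta omega) => //.
- exact: cross_diff_split.
- exact: cross_diff_swap13.
- exact: cross_diff_2143.
- exact: cross_diff_4321.
- move=> x y a b w d1 d2 nbw'.
  have [abw adm] := distinct5_admissible d1 d2 nbw'.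
  have [nxy nxa nxb [nya nyb nab']] := d1; have [_ _ nxw [_ nyw naw']] := d2.
  have [/(_ nya nyb) + _] := AB _ _ _ abw _ _ adm.
  rewrite !(sub_Mobius_cross_diff hM) //.
  by rewrite /coord_a /coord_b /tnth /= => -[]; rewrite opprK.
- move=> x y a b w d1 d2 nbw'.
  have [abw adm] := distinct5_admissible d1 d2 nbw'.
  have [nxy nxa nxb [nya nyb nab']] := d1; have [_ _ nxw [_ nyw naw']] := d2.
  have [_ /(_ nya nyw)] := AB _ _ _ abw _ _ adm.
  rewrite !(sub_Mobius_cross_diff hM) //.
  by rewrite /coord_a /coord_b /tnth /= => -[]; rewrite opprK.
Qed.
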